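(* Let $\lambda=(\lambda_1,\lambda_2)$ be a partition with two rows ($\lambda_1\ge\lambda_2\ge 1$), let $P=P_\lambda$ be its cell poset, and suppose that $\alpha,\beta\in P$ are incomparable. Then $\alpha$ and $\beta$ belong to different rows, and there are two cases. (1) If $\alpha=(1,a)$, $\beta=(2,b)$ with $1\le b<a\le\lambda_1$, then \begin{align*} A_P(\alpha)&=(a-1),\\ G_P(\alpha,\beta)&=\{(2,j)\mid 1\le j<b\},\\ D_P(\alpha,\beta)&=(a-1,b-1),\\ \mathcal{BI}_P(\alpha<\beta)&=\{(a-1,t)\mid 0\le t\le b-1\},\\ e(P;\alpha<\beta)&=\sum_{t=0}^{b-1} f^{(a-1,t)}\,f^{\lambda/(a,t)} = f^{(a-1)}f^{\lambda/(a)}+\sum_{t=1}^{b-1} f^{(a-1,t)}\,f^{(\lambda_1-t,\lambda_2-t)/(a-t)}. \end{align*} (2) If $\alpha=(2,a)$, $\beta=(1,b)$ with $1\le a<b\le\lambda_1$, then \begin{align*} A_P(\alpha)&=(a,a-1),\\ G_P(\alpha,\beta)&=\{(1,j)\mid a<j<b\},\\ D_P(\alpha,\beta)&=(b-1,a-1),\\ \mathcal{BI}_P(\alpha<\beta)&=\{(t,a-1)\mid a\le t\le b-1\},\\ e(P;\alpha<\beta)&=\sum_{t=a}^{b-1} f^{(t,a-1)}\,f^{\lambda/(t,a)} =\sum_{t=a}^{b-1} f^{(t,a-1)}\,f^{(\lambda_1-a,\lambda_2-a)/(t-a)}. \end{align*}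
   Context: The cell poset $P_\lambda$ of a partition $\lambda=(\lambda_1,\dots,\lambda_d)$ is the set of cells $\{(i,j)\mid 1\le i\le d,\ 1\le j\le\lambda_i\}$ ordered componentwise: $(i,j)\le(i',j')$ iff $i\le i'$ and $j\le j'$. A subpartition $\mu\subseteq\lambda$ (i.e. $\mu_i\le\lambda_i$ for all $i$) is identified with the order ideal of $P_\lambda$ consisting of its cells; trailing zero parts are ignored (so $(m,0)=(m)$ and $(0)$ is the empty partition). $P_{\lambda/\mu}$ is the subposet of $P_\lambda$ formed by the cells of $\lambda$ not in $\mu$. For a finite poset $Q$ with $n$ elements, a linear extension is a listing $\phi(1),\dots,\phi(n)$ of all elements of $Q$ such that $i<j$ implies $\phi(i)\not>\phi(j)$; $e(Q)$ is the number of linear extensions, and $e(Q;\alpha<\beta)$ is the number of linear extensions in which $\alpha$ is listed before $\beta$. Put $f^\lambda=e(P_\lambda)$ and $f^{\lambda/\mu}=e(P_{\lambda/\mu})$ (the numbers of standard Young tableaux of shape $\lambda$, respectively $\lambda/\mu$; equal to $1$ for the empty shape). For incomparable $\alpha,\beta$ in a finite poset $P$: - $D_P(\alpha,\beta)=\{z\in P\mid z\not\ge\alpha,\ z\not\ge\beta\}$ (complete ideal); - $A_P(\alpha)=\{z\in P\mid z<\alpha\}$ (fixed part); - $G_P(\alpha,\beta)=D_P(\alpha,\beta)\setminus A_P(\alpha)$ (variable part); - $\mathcal{BI}_P(\alpha<\beta)$ is the set of blocking ideals, i.e. the set of order ideals (down-closed subsets) $T$ of $P$ with $\alpha\notin T$,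 $\beta\notin T$ and $T\cup\{\alpha\}$ an order ideal of $P$. *)

(* Defs.v *)
From mathcomp Require Import all_boot all_order.
From mathcomp Require Import finmap.

Set Implicit Arguments.
Unset Strict Implicit.
Unset Printing Implicit Defensive.

Import Order.TTheory.

Local Open Scope order_scope.
Local Open Scope fset_scope.

(* A finite poset is a finite subset P of a partially ordered type, with the
   induced order; its subposets and order ideals are then finite sets in the
   same ambient type. *)
Section FinitePosets.
Context {disp : Order.disp_t} {T : porderType disp}.
Implicit Types (P I : {fset T}) (alpha beta : T).

Definition linear_extensions P : seq (seq T) :=
  [seq s <- permutations P | pairwise (fun x y => ~~ (x > y)) s].

Definition num_le P : nat := size (linear_extensions P).

Definition num_le_before P alpha beta : nat :=
  count (fun s => index alpha s < index beta s)%N (linear_extensions P).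

Definition order_ideal P I : bool :=
  (I `<=` P) && [forall x : P, forall y : P,
    (val y <= val x) ==> (val x \in I) ==> (val y \in I)].

Definition complete_ideal P alpha beta : {fset T} :=
  [fset z in P | ~~ (z >= alpha) & ~~ (z >= beta)].

Definition fixed_part P alpha : {fset T} := [fset z in P | z < alpha].

Definition variable_part P alpha beta : {fset T} :=
  complete_ideal P alpha beta `\` fixed_part P alpha.

Definition blocking_ideals P alpha beta : {fset {fset T}} :=
  [fset I in fpowerset P | [&& order_ideal P I, alpha \notin I, beta \notin I
                             & order_ideal P (alpha |` I)]].

End FinitePosets.

(* nat *p nat carries the componentwise order (plain nat * nat would not). *)
Definition cell := (nat *p nat)%type.

(* Rows and columns are numbered from 1, so row i has length la`_(i - 1). *)
Definition diagram (la : seq nat) : {fset cell} :=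
  [fset ((i, j) : cell) | i in iota 1 (size la), j in iota 1 (nth 0%N la i.-1)].

Definition f_shape (la : seq nat) : nat := num_le (diagram la).

(* Only meaningful for subpartitions mu of la. *)
Definition f_skew (la mu : seq nat) : nat := num_le (diagram la `\` diagram mu).

(* Main.v *)
Require Import Defs.
From mathcomp Require Import all_boot all_order.
From mathcomp Require Import finmap zify.

(** In a linear extension of P listing alpha before beta, the elements listed
    before alpha form a blocking ideal I, and the elements listed after alpha
    form a linear extension of P minus (alpha |` I); conversely such pieces can
    be glued. Hence e(P; alpha < beta) is the sum over the blocking ideals I of
    e(I) * e(P \ (alpha |` I)). The order ideals of a two-row diagram are the
    diagrams of its two-row subpartitions, which makes the sum explicit, and a
    skew shape whose first t columns are empty can be translated t columns to
    the left without changing its poset. *)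

Set Implicit Arguments.
Unset Strict Implicit.
Unset Printing Implicit Defensive.

Import Order.TTheory.

(** * Linear extensions of finite posets and their transport along maps *)

Section LinearExtensions.
Local Open Scope order_scope.
Local Open Scope fset_scope.

Lemma in_fset_seq (K : choiceType) (s : seq K) x :
  (x \in [fset y in s]) = (x \in s).
Proof. by rewrite inE. Qed.

Lemma order_idealP (disp : Order.disp_t) (T : porderType disp) (P I : {fset T}) :
  reflect ({subset I <= P} /\
           forall x y, x \in P -> y \in P -> y <= x -> x \in I -> y \in I)
          (order_ideal P I).
Proof.
apply: (iffP andP) => -[sIP hI]; split; try exact/fsubsetP.
  move=> x y xP yP le_yx xI.
  by move/forallP/(_ [` xP])/forallP/(_ [` yP])/implyP/(_ le_yx)/implyP/(_ xI) : hI.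
apply/forallP => x; apply/forallP => y; apply/implyP => le_yx; apply/implyP.
exact: hI (fsvalP x) (fsvalP y) le_yx.
Qed.

Lemma mem_linear_extensions (disp : Order.disp_t) (T : porderType disp)
    (P : {fset T}) (s : seq T) :
  (s \in linear_extensions P) =
  [&& uniq s, [fset x in s] == P & pairwise (fun x y => ~~ (y < x)) s].
Proof.
rewrite mem_filter andbC mem_permutations andbA; congr andb.
apply/idP/andP => [sP | [us /eqP sP]].
  split; first by rewrite (perm_uniq sP) fset_uniq.
  by apply/eqP/fsetP => x; rewrite !inE (perm_mem sP).
by apply: uniq_perm; rewrite ?fset_uniq // -sP => x; rewrite !inE.
Qed.

Lemma linear_extensions_uniq (disp : Order.disp_t) (T : porderType disp)
  (P : {fset T}) : uniq (linear_extensions P).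
Proof. by rewrite filter_uniq ?permutations_uniq. Qed.

(** Mapping [f] over listings is injective and yields linear extensions again, since a strict
    inequality between images would come from one in [P]. *)
Lemma leq_num_le (disp disp' : Order.disp_t) (T : porderType disp)
    (T' : porderType disp') (P : {fset T}) (f : T -> T') :
  {in P &, injective f} -> {in P &, forall x y, f x < f y -> x < y} ->
  (num_le P <= num_le (f @` P))%N.
Proof.
move=> f_inj f_refl; rewrite /num_le -(size_map (map f)).
have subP s : s \in linear_extensions P -> {subset s <= P}.
  by rewrite mem_linear_extensions => /and3P[_ /eqP<- _] x; rewrite inE.
apply: uniq_leq_size => [|_ /mapP[s sP ->]].
  rewrite map_inj_in_uniq ?linear_extensions_uniq // => s t sP tP.
  by apply: (inj_in_map f_inj); apply/allP => x; apply: subP.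
have sub_s := subP _ sP; move: sP; rewrite !mem_linear_extensions.
move=> /and3P[us /eqP sP ps]; apply/and3P; split.
- by rewrite map_inj_in_uniq // => x y /sub_s xP /sub_s yP; apply: f_inj.
- apply/eqP/fsetP => y; rewrite inE; apply/mapP/imfsetP => -[x xs ->];
    by exists x => //; move: xs; rewrite -sP !inE.
- rewrite pairwise_map; apply: sub_in_pairwise ps; last by apply/allP=> x; apply: sub_s.
  by move=> x y xP yP /=; apply: contra; apply: f_refl.
Qed.

(** Both [f] and its inverse [g] satisfy the hypotheses of [leq_num_le], so the two counts bound
    each other. *)
Lemma num_le_imfset (disp disp' : Order.disp_t) (T : porderType disp)
    (T' : porderType disp') (P : {fset T}) (f : T -> T') (g : T' -> T) :
  {in P, cancel f g} -> {in P &, {mono f : x y / x <= y}} ->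
  num_le (f @` P) = num_le P.
Proof.
move=> fK f_mono; apply/eqP; rewrite eqn_leq.
have f_inj : {in P &, injective f} by exact: can_in_inj fK.
have f_lt : {in P &, {mono f : x y / x < y}}.
  by move=> x y xP yP; rewrite !lt_neqAle f_mono // (inj_in_eq f_inj).
apply/andP; split; last by apply: leq_num_le => // x y xP yP; rewrite f_lt.
(* Seeing [P] as the image under [g] of its image under [f] puts the reverse bound in the form of
   [leq_num_le]. *)
have -> : num_le P = num_le (g @` (f @` P)).
  congr num_le; apply/fsetP => x; apply/idP/imfsetP => [xP | [_ /imfsetP[y yP ->] ->]].
    by exists (f x); rewrite ?fK //; apply/imfsetP; exists x.
  by rewrite fK.
apply: leq_num_le => [_ _ /imfsetP[x xP ->] /imfsetP[y yP ->]|].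
  by rewrite !fK // => ->.
by move=> _ _ /imfsetP[x xP ->] /imfsetP[y yP ->]; rewrite !fK // f_lt.
Qed.

(** * Counting linear extensions by the ideal listed before [alpha] *)

Section BlockingIdeals.
Context {disp : Order.disp_t} {T : porderType disp}.
Implicit Types (P I : {fset T}) (alpha beta : T) (s : seq T).

Lemma blocking_idealsP P alpha beta I :
  reflect [/\ order_ideal P I, alpha \notin I, beta \notin I
             & order_ideal P (alpha |` I)]
          (I \in blocking_ideals P alpha beta).
Proof.
rewrite !inE /= fpowersetE; apply: (iffP andP) => [[_ /and4P]|] // hI.
by split; [case: hI => /andP[] | apply/and4P].
Qed.

(** Only pairs across the cut need an argument: nothing listed after [s1] lies below an element of
    [I], as [I] is down-closed, and nothing in [s2] lies below [alpha], as [I] with [alpha] added is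
    down-closed. *)
Lemma linear_extension_cat P alpha beta I s1 s2 :
  alpha \in P -> I \in blocking_ideals P alpha beta ->
  s1 \in linear_extensions I -> s2 \in linear_extensions (P `\` (alpha |` I)) ->
  s1 ++ alpha :: s2 \in linear_extensions P.
Proof.
move=> alphaP /blocking_idealsP[idI aI bI idaI].
rewrite !mem_linear_extensions => /and3P[u1 /eqP s1I p1] /and3P[u2 /eqP s2P p2].
have s1E x : (x \in s1) = (x \in I) by rewrite -s1I inE.
have s2E x : (x \in s2) = (x \in P `\` (alpha |` I)) by rewrite -s2P inE.
have [sIP dI] := order_idealP _ _ idI; have [_ daI] := order_idealP _ _ idaI.
apply/and3P; split.
- rewrite cat_uniq u1 /= u2 s1E (negPf aI) s2E !inE eqxx !andbT /=.
  apply/hasPn => x; rewrite s2E s1E !inE => /andP[].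
  by rewrite negb_or => /andP[].
- apply/eqP/fsetP => x; rewrite in_fset_seq mem_cat inE s1E s2E !inE.
  case: (boolP (x \in I)) => [/sIP -> //|_] /=.
  by case: eqP => [->|].
- rewrite pairwise_cat p1 /= p2 andbT; apply/andP; split.
    apply/allrelP => x y; rewrite s1E inE s2E => xI yas2; apply/negP => lt_yx.
    have yP : y \in P by case/orP: yas2 => [/eqP-> //|]; rewrite inE => /andP[].
    have yI := dI _ _ (sIP _ xI) yP (ltW lt_yx) xI.
    by case/orP: yas2 => [/eqP eya|]; [rewrite -eya yI in aI | rewrite !inE yI orbT].
  apply/allP => x; rewrite s2E !inE => /andP[xnaI xP]; apply/negP => lt_xa.
  by rewrite -in_fset1U (daI _ _ alphaP xP (ltW lt_xa)) ?fset1U1 in xnaI.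
Qed.

(** The ideal is the set of entries preceding [alpha]. It is down-closed, with or without [alpha],
    because no entry lies below an earlier one; it misses [beta], which comes later. *)
Lemma linear_extension_split P alpha beta s :
  beta \in P -> s \in linear_extensions P -> (index alpha s < index beta s)%N ->
  exists I s1 s2, [/\ I \in blocking_ideals P alpha beta,
    s1 \in linear_extensions I, s2 \in linear_extensions (P `\` (alpha |` I))
    & s = s1 ++ alpha :: s2].
Proof.
rewrite mem_linear_extensions => betaP /and3P[us /eqP sP ps] lt_ab.
have betas : beta \in s by rewrite -sP in_fset_seq in betaP.
have alphas : alpha \in s by rewrite -index_mem (ltn_trans lt_ab) ?index_mem.
move: us sP ps lt_ab {betas}; case/splitPr: alphas => s1 s2.
rewrite cat_uniq pairwise_cat /= => /and4P[u1 /norP[as1 dis] as2 u2] sP.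
move=> /and3P[/allrelP p12 p1 /andP[pa p2]].
rewrite !index_cat (negPf as1) /= eqxx addn0 => lt_ab.
have bs1 : beta \notin s1.
  by apply/negP => bs1; move: lt_ab; rewrite bs1 ltnNge ltnW ?index_mem.
have PE x : (x \in P) = (x \in s1) || (x == alpha) || (x \in s2).
  by rewrite -sP in_fset_seq mem_cat inE orbA.
have dis2 x : x \in s2 -> x \notin s1 by move/(hasPn dis).
exists [fset x in s1], s1, s2; split => //.
- apply/blocking_idealsP; split; rewrite ?inE //; apply/order_idealP; split.
  + by move=> x; rewrite in_fset_seq PE => ->.
  + move=> x y xP; rewrite !in_fset_seq PE -orbA => /orP[-> //|yas2] le_yx xs1.
    (* The listing rules out [y < x], so [y <= x] leaves only [y = x]. *)
    have := p12 x y xs1; rewrite inE => /(_ yas2).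
    by rewrite lt_neqAle le_yx andbT negbK => /eqP->.
  + by move=> x; rewrite in_fset1U in_fset_seq PE => /orP[->|->]; rewrite ?orbT.
  + move=> x y xP; rewrite !in_fset1U !in_fset_seq PE (orbC (y == alpha)) => /orP[-> //|ys2] le_yx.
    case/orP => [/eqP ex|xs1].
      have := allP pa _ ys2; rewrite lt_neqAle -ex le_yx andbT negbK => /eqP->.
      by rewrite eqxx orbT.
    have := p12 x y xs1; rewrite inE ys2 orbT => /(_ isT).
    by rewrite lt_neqAle le_yx andbT negbK => /eqP->; rewrite xs1.
- by rewrite mem_linear_extensions u1 eqxx.
- rewrite mem_linear_extensions u2 p2 andbT /=; apply/eqP/fsetP => x.
  rewrite in_fset_seq in_fsetD in_fset1U in_fset_seq PE; case: (boolP (x \in s2)) => [xs2|_]; last first.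
    by rewrite orbF orbC andNb.
  by rewrite orbT andbT negb_or (dis2 _ xs2) andbT; apply/esym; apply: contraNneq as2 => <-.
Qed.

(** Gluing produces no listing twice: [alpha] does not occur in [s1], so its position recovers [s1]
    and [s2], and [I] is the set of entries of [s1]. *)
Lemma num_le_before_sum P alpha beta :
  alpha \in P -> beta \in P -> alpha != beta ->
  num_le_before P alpha beta =
  (\sum_(I <- blocking_ideals P alpha beta)
     num_le I * num_le (P `\` (alpha |` I)))%N.
Proof.
move=> alphaP betaP neq_ab.
pose glue I := [seq s1 ++ alpha :: s2 | s1 <- linear_extensions I,
                                  s2 <- linear_extensions (P `\` (alpha |` I))].
pose L := [seq s | J <- blocking_ideals P alpha beta, s <- glue J].
have prefixP I s1 : I \in blocking_ideals P alpha beta ->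
  s1 \in linear_extensions I -> alpha \notin s1 /\ I = [fset x in s1].
  case/blocking_idealsP => _ aI bI _; rewrite mem_linear_extensions.
  by move=> /and3P[_ /eqP eI _]; split => //; rewrite -eI in_fset_seq in aI.
have cat_inj s1 t1 s2 t2 : alpha \notin s1 -> alpha \notin t1 ->
    s1 ++ alpha :: s2 = t1 ++ alpha :: t2 -> s1 = t1 /\ s2 = t2.
  move=> as1 at1 e; have /eqP := e; rewrite eqseq_cat ?eqseq_cons.
    by case/and3P => /eqP-> _ /eqP->.
  (* The side condition of [eqseq_cat]: both prefixes have the length given by the index of
     [alpha]. *)
  by have /(congr1 (index alpha)) := e; rewrite !index_cat (negPf as1) (negPf at1) /= eqxx !addn0.
rewrite /num_le_before -size_filter.
have -> : size [seq s <- linear_extensions P | index alpha s < index beta s]%N = size L.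
  apply/perm_size/uniq_perm.
  - by rewrite filter_uniq ?linear_extensions_uniq.
  - apply: allpairs_uniq_dep => [|I BI|]; first exact: fset_uniq.
      apply: allpairs_uniq_dep => [|s1 _|]; try exact: linear_extensions_uniq.
      move=> _ _ /allpairsPdep[s1 [s2 [s1I s2I ->]]] /allpairsPdep[t1 [t2 [t1I t2I ->]]] /=.
      have [as1 _] := prefixP _ _ BI s1I; have [at1 _] := prefixP _ _ BI t1I.
      by move=> /(cat_inj _ _ _ _ as1 at1)[-> ->].
    move=> _ _ /allpairsPdep[I [s [BI sI ->]]] /allpairsPdep[J [t [BJ tJ ->]]] /= est.
    case/allpairsPdep: sI est => s1 [s2 [s1I s2I ->]].
    case/allpairsPdep: tJ => t1 [t2 [t1J t2J ->]].
    have [as1 ->] := prefixP _ _ BI s1I; have [at1 ->] := prefixP _ _ BJ t1J.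
    by move=> /(cat_inj _ _ _ _ as1 at1)[-> ->].
  - move=> s; rewrite mem_filter; apply/andP/allpairsPdep => [[lt_ab sP]|].
      have [I [s1 [s2 [BI s1I s2I ->]]]] := linear_extension_split betaP sP lt_ab.
      by exists I, (s1 ++ alpha :: s2); split => //; apply/allpairsPdep; exists s1, s2.
    case=> I [_ [BI /allpairsPdep[s1 [s2 [s1I s2I ->]]] ->]].
    split; last exact: (linear_extension_cat alphaP BI s1I s2I).
    have [as1 eI] := prefixP _ _ BI s1I.
    have /blocking_idealsP[_ _ bI _] := BI; rewrite eI in_fset_seq in bI.
    by rewrite !index_cat (negPf as1) (negPf bI) /= eqxx (negPf neq_ab) addn0 -addSnnS leq_addr.
rewrite /L size_allpairs_dep sumnE big_map; apply: eq_bigr => I _.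
by rewrite size_allpairs.
Qed.

End BlockingIdeals.
End LinearExtensions.

(** * Two-row diagrams, their order ideals and column translations *)

Lemma in_diagram (la : seq nat) (c : cell) :
  (c \in diagram la) = [&& 0 < c.1, c.1 <= size la, 0 < c.2 & c.2 <= nth 0 la c.1.-1].
Proof.
case: c => i j; apply/imfset2P/and4P => /= [[i' iP [j' jP [-> ->]]]|[i_gt0 i_le j_gt0 j_le]].
  by move: iP jP; rewrite /= !mem_iota => /andP[? ?] /andP[? ?]; split=> //; lia.
by exists i; rewrite /= ?mem_iota; [lia | exists j; rewrite //= mem_iota; lia].
Qed.

Lemma in_diagram1 m i j :
  (((i, j) : cell) \in diagram [:: m]) = (i == 1) && (0 < j <= m).
Proof. by rewrite in_diagram; case: i => [|[|i]]. Qed.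

Lemma in_diagram2 m n i j :
  (((i, j) : cell) \in diagram [:: m; n]) =
  (i == 1) && (0 < j <= m) || (i == 2) && (0 < j <= n).
Proof. by rewrite in_diagram; case: i => [|[|[|i]]] //=; rewrite orbF. Qed.

Lemma le_cellE (i j i' j' : nat) :
  (((i, j) : cell) <= (i', j'))%O = (i <= i') && (j <= j').
Proof. by []. Qed.

Lemma lt_cellE (i j i' j' : nat) :
  (((i, j) : cell) < (i', j'))%O = [&& (i != i') || (j != j'), i <= i' & j <= j'].
Proof. by rewrite lt_neqAle le_cellE xpair_eqE negb_and. Qed.

Lemma order_ideal_diagram2 l1 l2 t1 t2 :
  t2 <= t1 -> t1 <= l1 -> t2 <= l2 ->
  order_ideal (diagram [:: l1; l2]) (diagram [:: t1; t2]).
Proof.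
move=> le21 le1 le2; apply/order_idealP; split => [[i j]|[i j] [i' j']].
  by rewrite !in_diagram2; lia.
by rewrite !in_diagram2 le_cellE; lia.
Qed.

(** Down-closure within a row makes each row of [I] an initial segment; down-closure from row 2 to
    row 1 makes the lengths weakly decreasing. *)
Lemma order_ideal_diagram2P l1 l2 (I : {fset cell}) :
  l2 <= l1 -> order_ideal (diagram [:: l1; l2]) I ->
  exists t1 t2, [/\ t2 <= t1, t1 <= l1, t2 <= l2 & I = diagram [:: t1; t2]].
Proof.
move=> le21 /order_idealP[sub_I down_I].
have row i : exists t, forall j, (((i, j) : cell) \in I) = (0 < j <= t).
  have ex_t : exists t, ((i, t.+1) : cell) \notin I.
    (* The column after [maxn l1 l2] is past the end of both rows, so a least [t] exists; it is the
       length of row [i] of [I]. *)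
    exists (maxn l1 l2); apply/negP => /sub_I.
    by rewrite in_diagram2; lia.
  exists (ex_minn ex_t); case: ex_minnP => t tnI t_min j.
  apply/idP/andP => [jI|[j_gt0 le_jt]].
    have j_gt0 : 0 < j by have := sub_I _ jI; rewrite in_diagram2; lia.
    split => //; rewrite leqNgt; apply/negP => lt_tj.
    move/negP: tnI; apply; apply: (down_I _ _ (sub_I _ jI) _ _ jI).
      by have := sub_I _ jI; rewrite !in_diagram2; lia.
    by rewrite le_cellE; lia.
  (* Were [(i, j)] outside [I], minimality at [j.-1] would give [t <= j.-1], against [j <= t]. *)
  apply: contraT => jnI; have := t_min j.-1; rewrite prednK // => /(_ jnI); lia.
have [t1 t1P] := row 1; have [t2 t2P] := row 2.
have le_t1 : t1 <= l1.
  by case: (posnP t1) => [->//|t1_gt0]; have := sub_I (1, t1); rewrite t1P in_diagram2; lia.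
have le_t2 : t2 <= l2.
  by case: (posnP t2) => [->//|t2_gt0]; have := sub_I (2, t2); rewrite t2P in_diagram2; lia.
exists t1, t2; split => //.
  case: (posnP t2) => [->//|t2_gt0].
  have := down_I (2, t2) (1, t2); rewrite t1P t2P !in_diagram2 le_cellE; lia.
apply/fsetP => -[i j]; rewrite in_diagram2 -t1P -t2P.
apply/idP/idP => [ijI|/orP[]/andP[/eqP->]//].
by have := sub_I _ ijI; rewrite in_diagram2; case: eqP => [<-|_]; case: eqP => [<-|_] //; rewrite ijI.
Qed.

(** Both removed rows have length at least [t], so the remaining cells lie beyond column [t] and
    translation is an order isomorphism. The second removed row becomes empty. *)
Lemma f_skew_shift l1 l2 m t :
  t <= m -> t <= l1 -> t <= l2 ->
  f_skew [:: l1; l2] [:: m; t] = f_skew [:: l1 - t; l2 - t] [:: m - t].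
Proof.
move=> le_tm le_tl1 le_tl2; rewrite /f_skew.
pose up (c : cell) : cell := (c.1, c.2 + t).
pose down (c : cell) : cell := (c.1, c.2 - t).
set Q := (X in _ = num_le X).
rewrite -(@num_le_imfset _ _ _ _ Q up down) => [|[i j] _|[i j] [i' j'] _ _].
- congr num_le; apply/fsetP => -[i j].
  rewrite in_fsetD !in_diagram2; apply/idP/imfsetP => [ijP|[[i' j'] + [-> ->]]].
    (* A cell outside the removed shape has [j > t], so the truncated subtraction is exact. *)
    exists (i, j - t); last by rewrite /up /=; congr pair; lia.
    by rewrite /= in_fsetD in_diagram1 in_diagram2; lia.
  by rewrite /= in_fsetD in_diagram1 in_diagram2; lia.
- by rewrite /down /up /= addnK.
- by rewrite !le_cellE /=; lia.
Qed.

Lemma diagram_zero_row m : diagram [:: m; 0] = diagram [:: m].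
Proof. by apply/fsetP => -[i j]; rewrite in_diagram1 in_diagram2; lia. Qed.

(** Injectivity of [D] keeps distinct indices from collapsing in the finite set. *)
Lemma big_fset_index_iota (K : choiceType) (F : K -> nat) (D : nat -> K) m n :
  injective D ->
  \sum_(I <- [fset D t | t in index_iota m n]%fset) F I = \sum_(m <= t < n) F (D t).
Proof.
move=> D_inj; rewrite -(big_map D xpredT F); apply/perm_big/uniq_perm.
- exact: fset_uniq.
- by rewrite map_inj_uniq ?iota_uniq.
- by move=> x; apply/imfsetP/mapP => -[t]; exists t.
Qed.

(** Testing the end cells of the rows of each diagram in the other bounds every row length both
    ways. *)
Lemma diagram2_inj t1 t2 u1 u2 :
  diagram [:: t1; t2] = diagram [:: u1; u2] -> t1 = u1 /\ t2 = u2.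
Proof.
move=> /fsetP e; have eD i j := e (i, j).
move: (eD 1 t1) (eD 1 u1) (eD 2 t2) (eD 2 u2); rewrite !in_diagram2; lia.
Qed.

(** * The two relative positions of incomparable cells in a two-row diagram *)

Theorem theorem4p2 (l1 l2 : nat) (l2_le_l1 : (l2 <= l1)%N) (l2_gt0 : (1 <= l2)%N)
    (alpha beta : cell)
    (alphaP : alpha \in diagram [:: l1; l2])
    (betaP : beta \in diagram [:: l1; l2])
    (incomp : (alpha >< beta)%O) :
  let la := [:: l1; l2] in
  let P := diagram la in
  alpha.1 <> beta.1 /\
  ((exists a b : nat, [/\ alpha = (1, a), beta = (2, b) & [&& 1 <= b, b < a & a <= l1]]%N) \/
   (exists a b : nat, [/\ alpha = (2, a), beta = (1, b) & [&& 1 <= a, a < b & b <= l1]]%N)) /\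
  (forall a b : nat, alpha = (1, a)%N -> beta = (2, b)%N -> [&& 1 <= b, b < a & a <= l1]%N ->
    fixed_part P alpha = diagram [:: a.-1] /\
    variable_part P alpha beta =
      [fset ((2, j)%N : cell) | j in index_iota 1 b]%fset /\
    complete_ideal P alpha beta = diagram [:: a.-1; b.-1] /\
    blocking_ideals P alpha beta =
      [fset diagram [:: a.-1; t] | t in index_iota 0 b]%fset /\
    num_le_before P alpha beta =
      (\sum_(0 <= t < b) f_shape [:: a.-1; t] * f_skew la [:: a; t])%N /\
    (\sum_(0 <= t < b) f_shape [:: a.-1; t] * f_skew la [:: a; t] =
     f_shape [:: a.-1] * f_skew la [:: a] +
     \sum_(1 <= t < b)
       f_shape [:: a.-1; t] * f_skew [:: l1 - t; l2 - t] [:: a - t])%N) /\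
  (forall a b : nat, alpha = (2, a)%N -> beta = (1, b)%N -> [&& 1 <= a, a < b & b <= l1]%N ->
    fixed_part P alpha = diagram [:: a; a.-1] /\
    variable_part P alpha beta =
      [fset ((1, j)%N : cell) | j in index_iota a.+1 b]%fset /\
    complete_ideal P alpha beta = diagram [:: b.-1; a.-1] /\
    blocking_ideals P alpha beta =
      [fset diagram [:: t; a.-1] | t in index_iota a b]%fset /\
    num_le_before P alpha beta =
      (\sum_(a <= t < b) f_shape [:: t; a.-1] * f_skew la [:: t; a])%N /\
    (\sum_(a <= t < b) f_shape [:: t; a.-1] * f_skew la [:: t; a] =
     \sum_(a <= t < b)
       f_shape [:: t; a.-1] * f_skew [:: l1 - a; l2 - a] [:: t - a])%N).

Proof.
move=> la P; case: alpha alphaP betaP incomp => a1 a2; case: beta => b1 b2.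
move=> alphaP betaP incomp.
split; last split; [| |split].
- move: alphaP betaP incomp; rewrite /P !in_diagram2 /Order.comparable !le_cellE /=; lia.
(* If the first-row cell were not strictly to the right, it would lie below the second-row cell. *)
- have : (a1 == 1) && (b1 == 2) && [&& 1 <= b2, b2 < a2 & a2 <= l1] ||
         (a1 == 2) && (b1 == 1) && [&& 1 <= a2, a2 < b2 & b2 <= l1].
    by move: alphaP betaP incomp; rewrite /P !in_diagram2 /Order.comparable !le_cellE; lia.
  by case/orP => /andP[/andP[/eqP-> /eqP->] ?]; [left | right]; exists a2, b2.
- move=> a b [ea1 ea2] [eb1 eb2]; subst a1 a2 b1 b2 => /and3P[b_gt0 lt_ba le_al1].
  have le_bl2 : b <= l2 by move: betaP; rewrite in_diagram2; lia.
  have BIE : blocking_ideals P (1, a) (2, b) =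
      [fset diagram [:: a.-1; t] | t in index_iota 0 b]%fset.
    apply/fsetP => I; apply/blocking_idealsP/imfsetP => [[idI aI bI idaI]|[t]].
      have [t1 [t2 [le21 le1 le2 eI]]] := order_ideal_diagram2P l2_le_l1 idI.
      move: aI bI idaI; rewrite eI !in_diagram2 => aI bI /order_idealP[_ down].
      exists t2; first by rewrite /= mem_index_iota; lia.
      (* Since [alpha] is not in [I], [t1 < a]. For [a = 1] this forces [t1 = 0]; otherwise
         [(1, a.-1)] is a cell below [alpha], hence in [I], and [t1 = a.-1]. *)
      congr (diagram [:: _; _]); have [a1|a_gt1] := leqP a 1; first by lia.
      have := down (1, a) (1, a.-1); rewrite !in_fset1U !in_diagram2 le_cellE !xpair_eqE.
      lia.
    rewrite /= mem_index_iota => lt_tb ->.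
    have -> : ((1, a) |` diagram [:: a.-1; t])%fset = diagram [:: a; t].
      by apply/fsetP => -[i j]; rewrite in_fset1U !in_diagram2 xpair_eqE; lia.
    by rewrite !in_diagram2; split; rewrite ?order_ideal_diagram2; lia.
  split; [|split; [|split; [|split; [|split]]]] => //.
  + by apply/fsetP => -[i j]; rewrite !inE /= in_diagram1 in_diagram2 lt_cellE; lia.
  + apply/fsetP => -[i j]; apply/idP/imfsetP => [|[k]].
      rewrite !inE /= !in_diagram2 lt_cellE !le_cellE => ijP.
      by exists j; [rewrite /= mem_index_iota; lia | congr pair; lia].
    rewrite /= mem_index_iota => kP [-> ->].
    by rewrite !inE /= !in_diagram2 lt_cellE !le_cellE; lia.
  + by apply/fsetP => -[i j]; rewrite !inE /= !in_diagram2 !le_cellE; lia.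
  + rewrite num_le_before_sum // BIE big_fset_index_iota; last first.
      by move=> t u /diagram2_inj[].
    apply: eq_big_nat => t lt_tb; congr (_ * num_le _).
    (* Removing [alpha] as well extends the first removed row from [a.-1] to [a]. *)
    by apply/fsetP => -[i j]; rewrite !in_fsetD in_fset1U !in_diagram2 xpair_eqE; lia.
  (* At [t = 0] the empty second row is dropped; for the other terms [t < b <= l2] and [t < a]
     permit the translation by [t] columns. *)
  + rewrite big_ltn //; congr (_ + _).
      by rewrite /f_shape /f_skew !diagram_zero_row.
    by apply: eq_big_nat => t lt_tb; rewrite (@f_skew_shift l1 l2 a t) //; lia.
- move=> a b [ea1 ea2] [eb1 eb2]; subst a1 a2 b1 b2 => /and3P[a_gt0 lt_ab le_bl1].
  have le_al2 : a <= l2 by move: alphaP; rewrite in_diagram2; lia.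
  have BIE : blocking_ideals P (2, a) (1, b) =
      [fset diagram [:: t; a.-1] | t in index_iota a b]%fset.
    apply/fsetP => I; apply/blocking_idealsP/imfsetP => [[idI aI bI idaI]|[t]].
      have [t1 [t2 [le21 le1 le2 eI]]] := order_ideal_diagram2P l2_le_l1 idI.
      move: aI bI idaI; rewrite eI !in_diagram2 => aI bI /order_idealP[_ down].
      (* The cell [(1, a)] lies strictly below [alpha], hence in [I], so [a <= t1]; as [beta] is not
         in [I], [t1 < b]. *)
      have := down (2, a) (1, a); rewrite !in_fset1U !in_diagram2 le_cellE !xpair_eqE => t1P.
      exists t1; first by rewrite /= mem_index_iota; lia.
      congr (diagram [:: _; _]); have [a1|a_gt1] := leqP a 1; first by lia.
      have := down (2, a) (2, a.-1); rewrite !in_fset1U !in_diagram2 le_cellE !xpair_eqE.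
      lia.
    rewrite /= mem_index_iota => lt_tb ->.
    have -> : ((2, a) |` diagram [:: t; a.-1])%fset = diagram [:: t; a].
      by apply/fsetP => -[i j]; rewrite in_fset1U !in_diagram2 xpair_eqE; lia.
    by rewrite !in_diagram2; split; rewrite ?order_ideal_diagram2; lia.
  split; [|split; [|split; [|split; [|split]]]] => //.
  + by apply/fsetP => -[i j]; rewrite !inE /= !in_diagram2 lt_cellE; lia.
  + apply/fsetP => -[i j]; apply/idP/imfsetP => [|[k]].
      rewrite !inE /= !in_diagram2 lt_cellE !le_cellE => ijP.
      by exists j; [rewrite /= mem_index_iota; lia | congr pair; lia].
    rewrite /= mem_index_iota => kP [-> ->].
    by rewrite !inE /= !in_diagram2 lt_cellE !le_cellE; lia.
  + by apply/fsetP => -[i j]; rewrite !inE /= !in_diagram2 !le_cellE; lia.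
  + rewrite num_le_before_sum // BIE big_fset_index_iota; last first.
      by move=> t u /diagram2_inj[].
    apply: eq_big_nat => t lt_tb; congr (_ * num_le _).
    by apply/fsetP => -[i j]; rewrite !in_fsetD in_fset1U !in_diagram2 xpair_eqE; lia.
  (* Here [a <= t] and [a <= l2], so the translation by the fixed number [a] of columns applies to
     every term. *)
  + by apply: eq_big_nat => t lt_tb; rewrite (@f_skew_shift l1 l2 t a) //; lia.
Qed.
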